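(* Let $n\geq 0$ and let $\bar a=(a_0,a_1,\dots,a_n)\in\mathbb{Z}_{+}^{n+1}$ with $a_0\geq 0$, $a_1,\dots,a_{n-1}\geq 1$ and $a_n\geq 2-\delta_{n,0}$. Put $$d=a_0+a_1+\cdots+a_n,\qquad \mu=\tfrac{2}{3}\bigl(4^{d-1}-1\bigr)-\sum_{i=1}^n 4^{a_i+\cdots+a_n-2}.$$ Then for every positive integer $K$ and every nonnegative integer $M$, $$G\bigl(M,M;((2\mu+1)K-1)/2^d,((2\mu+1)K+1)/2^d,2^{d-1}K\bigr)\geq 0.$$
   Context: $\mathbb{Z}_+=\{0,1,2,\dots\}$. The Gaussian polynomial is $\left[\begin{smallmatrix}m+n\\ m\end{smallmatrix}\right]=\prod_{k=1}^m\frac{1-q^{n+k}}{1-q^k}$ if $m,n\in\mathbb{Z}_+$ and $0$ otherwise. For $N,M$ integers, $K$ an integer and $\alpha,\beta$ reals, $$G(N,M;\alpha,\beta,K)=\sum_{j=-\infty}^{\infty}(-1)^j q^{Kj((\alpha+\beta)j+\alpha-\beta)/2}\begin{bmatrix}M+N\\ N-Kj\end{bmatrix}$$ (a finite sum). For such a finite sum $P$ of powers of $q$, $P\geq 0$ means that all its coefficients are nonnegative. *)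

(* Defs.v *)
From mathcomp Require Import all_boot all_order all_algebra.
From mathcomp Require Import classical_sets fsbigop reals.
From mathcomp Require Import monalg.

Set Implicit Arguments.
Unset Strict Implicit.
Unset Printing Implicit Defensive.

Import Order.TTheory GRing.Theory Num.Theory.
Local Open Scope classical_set_scope.
Local Open Scope ring_scope.

(* The division is exact; the divisor has leading coefficient +-1, so
   {poly int} division needs no extra scaling factor. *)
Definition gaussian_poly (m n : nat) : {poly int} :=
  (\prod_(1 <= k < m.+1) (1 - 'X^(n + k)))
    %/ (\prod_(1 <= k < m.+1) (1 - 'X^k)).

(* The bracket [t over b], i.e. [m+n over m] with m = b and n = t - b. *)
Definition qbinom (t b : int) : {poly int} :=
  if (0 <= b) && (0 <= t - b) then gaussian_poly `|b|%N `|t - b|%N else 0.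

Section GeneralizedPolynomials.
Variable R : realType.

(* {malg R} is the type of finite sums of c q^e with c : int and e : R;
   << c *g e >> is c q^e, and P@_e is the coefficient of q^e in P. *)
Definition qshift (e : R) (p : {poly int}) : {malg R} :=
  \sum_(i < size p) << p`_i *g e + i%:R >>.

(* For K != 0 the sum over all integers j has finite support. For K = 0, where
   the series is meaningless, \sum_(j \in _) may return the junk value 0. *)
Definition G (N M : int) (alpha beta : R) (K : int) : {malg R} :=
  \sum_(j \in [set: int])
    ((-1) ^ j : int) *:
      qshift (K%:~R * j%:~R * ((alpha + beta) * j%:~R + alpha - beta) / 2)
             (qbinom (M + N) (N - K * j)).

Definition coef_nonneg (P : {malg R}) : Prop := forall e : R, 0 <= P@_e.

End GeneralizedPolynomials.

Definition total_sum n (a : 'I_n.+1 -> nat) : nat := (\sum_(i < n.+1) a i)%N.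

Definition tail_sum n (a : 'I_n.+1 -> nat) (i : 'I_n.+1) : nat :=
  (\sum_(j < n.+1 | i <= j) a j)%N.

(* The exponents are integers, so that no subtraction is truncated. *)
Definition mu (R : realType) n (a : 'I_n.+1 -> nat) : R :=
  2 / 3 * (4 ^ ((total_sum a)%:Z - 1) - 1)
  - \sum_(i < n.+1 | (0 < i)%N) 4 ^ ((tail_sum a i)%:Z - 2).

(* Main.v *)
Require Import Defs.
From mathcomp Require Import all_boot all_order all_algebra.
From mathcomp Require Import reals.
From mathcomp Require Import classical_sets fsbigop monalg zify ring.

Import Order.TTheory GRing.Theory Num.Theory.
Local Open Scope ring_scope.

(** Write [cb L x] for the q-binomial [2L over L-x]. Applying q-Vandermonde
    twice to [cb L (2x)] gives
      q^(2x^2) cb L (2x) = sum_k A(L,k) cb k x,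
      q^(x^2)  cb L (2x) = sum_k C(L,k) cb k x,
    with kernels [A], [C] having nonnegative coefficients and not depending on
    [x]. In terms of [d] and [m = 2 mu + 1], the first identity carries
    positivity from [(d, m)] to [(d+1, m + 4^d)] and the second one to
    [(d+1, m + 4^d/2)]. The sequence [a] prescribes the order of the steps:
    starting from [d = m = 1], perform [A] (a_n - 2) times, then for each
    i = n-1, ..., 1 perform [C] once and [A] (a_i - 1) times, and finally [C]
    once and [A] a_0 times (for n = 0, just [A] a_0 - 1 times).
    For the initial case [d = m = 1], the sum is obtained from the coefficients
    in [z] of prod_(i<M) (1 + z q^i)(1 + q^(i+1)/z) by adding them up along
    multiples of [K] with alternating signs. The product is
    (1 + z)(1 + q^M/z) prod_(0<i<M) (1 + z q^i)(1 + q^i/z); multiplication by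
    the symmetric factors is a wave-like recursion which preserves
    antisymmetry about two walls and nonnegativity between them. *)

(** * q-binomials: Pascal rules, factorial formula, q-Vandermonde *)

Fixpoint qbin (n k : nat) : {poly int} :=
  match n, k with
  | _, 0%N => 1
  | 0%N, _.+1 => 0
  | n'.+1, k'.+1 => qbin n' k' + 'X^(k'.+1) * qbin n' k'.+1
  end.

Definition qpoch (n : nat) : {poly int} := \prod_(1 <= k < n.+1) (1 - 'X^k).

Lemma qbin0 n : qbin n 0 = 1. Proof. by case: n. Qed.

Lemma qbinS n k : qbin n.+1 k.+1 = qbin n k + 'X^(k.+1) * qbin n k.+1.
Proof. by []. Qed.

Lemma qbin_small n k : (n < k)%N -> qbin n k = 0.
Proof.
elim: n k => [|n IHn] [|k] //= lt_nk.
by rewrite !IHn ?mulr0 ?addr0 //; apply: leqW.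
Qed.

Lemma qbinnn n : qbin n n = 1.
Proof. by elim: n => [|n IHn] //=; rewrite IHn qbin_small // mulr0 addr0. Qed.

Arguments qbin : simpl never.

Lemma qpochS n : qpoch n.+1 = qpoch n * (1 - 'X^(n.+1)).
Proof. by rewrite /qpoch big_nat_recr. Qed.

Lemma onesubXn_neq0 n : (0 < n)%N -> 1 - 'X^n != 0 :> {poly int}.
Proof.
by case: n => // n _; rewrite -oppr_eq0 opprB monic_neq0 ?monicXnsubC.
Qed.

Lemma qpoch_neq0 n : qpoch n != 0.
Proof.
elim: n => [|n IHn]; first by rewrite /qpoch big_geq ?oner_neq0.
by rewrite qpochS mulf_neq0 ?onesubXn_neq0.
Qed.

Lemma qbin_qpoch m n : qbin (m + n) m * (qpoch m * qpoch n) = qpoch (m + n).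
Proof.
have qpoch0 : qpoch 0 = 1 by rewrite /qpoch big_geq.
elim: m n => [|m IHm] n; first by rewrite qbin0 qpoch0 !mul1r.
elim: n => [|n IHn]; first by rewrite addn0 qbinnn qpoch0 mul1r mulr1.
have := IHm n.+1; rewrite addnS => IHm'.
rewrite addSn in IHn.
rewrite addSn addnS qbinS; transitivity (qpoch (m + n).+1 * (1 - 'X^(m.+1))
    + 'X^(m.+1) * (qpoch (m + n).+1 * (1 - 'X^(n.+1)))).
  by rewrite -{1}IHm' -IHn !qpochS; ring.
by rewrite (qpochS (m + n).+1) -addnS -addSn exprD; ring.
Qed.

Lemma qbin_sym m n : qbin (m + n) m = qbin (m + n) n.
Proof.
have nz : qpoch m * qpoch n != 0 by rewrite mulf_neq0 ?qpoch_neq0.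
apply: (mulIf nz); rewrite qbin_qpoch mulrC [qpoch m * _]mulrC mulrC.
by rewrite [in RHS]addnC qbin_qpoch addnC.
Qed.

(** The second Pascal rule is the first one conjugated by the symmetry [qbin_sym]. *)
Lemma qbinS_dual n k :
  qbin n.+1 k.+1 = 'X^(n - k) * qbin n k + qbin n k.+1.
Proof.
have [lt_nk|] := ltnP n k.
  by rewrite !qbin_small ?mulr0 ?addr0 //; apply: leqW.
move=> /subnKC; move: (n - k)%N => [|m] <-.
  by rewrite addn0 !qbinnn qbin_small // mul1r addr0.
rewrite -[(k + m.+1).+1]/(k.+1 + m.+1)%N qbin_sym addSn qbinS -qbin_sym.
by rewrite -{1}addSnnS -qbin_sym addSnnS addrC.
Qed.

Lemma gaussian_polyE m n : gaussian_poly m n = qbin (m + n) m.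
Proof.
rewrite /gaussian_poly.
have num : \prod_(1 <= k < m.+1) (1 - 'X^(n + k)) = qbin (m + n) m * qpoch m.
  apply: (mulIf (qpoch_neq0 n)); rewrite -mulrA qbin_qpoch.
  elim: m => [|m IHm]; first by rewrite big_geq // mul1r.
  by rewrite big_nat_recr //= mulrAC IHm addSn qpochS addnS [(n + m)%N]addnC.
(* Cancelling [qpoch m] is legitimate over the integers because its leading coefficient, a product
   of factors -1, is a unit. *)
rewrite num -/(qpoch m) Pdiv.IdomainUnit.mulpK //.
elim: m {num} => [|m IHm]; first by rewrite /qpoch big_geq // lead_coef1.
rewrite qpochS lead_coefM unitrM IHm /= -opprB lead_coefN unitrN.
by rewrite (eqP (monicXnsubC _ _)).
Qed.

Lemma qbin_vandermonde m n k :
  qbin (m + n) k =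
  \sum_(i < k.+1) qbin m i * qbin n (k - i) * 'X^((k - i) * (m - i)).
Proof.
elim: n k => [|n IHn] k.
  rewrite addn0 big_ord_recr /= subnn mul0n !mulr1 big1 ?add0r ?qbin0 ?mulr1 //.
  by move=> i _; rewrite (qbin_small 0) ?subn_gt0 // mulr0 mul0r.
case: k => [|k]; first by rewrite big_ord1 !qbin0 !mulr1.
rewrite addnS qbinS_dual !IHn big_distrr /= [in RHS]big_ord_recr /=.
rewrite [X in _ + X = _]big_ord_recr /= addrA subnn !qbin0; congr (_ + _).
rewrite -big_split /=; apply: eq_bigr => i _.
have le_ik : (i <= k)%N by rewrite -ltnS.
rewrite subSn // qbinS_dual.
have [lt_mi|le_im] := ltnP m i.
  by rewrite !(qbin_small m i) // !mul0r mulr0 addr0.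
have [lt_nk|le_kn] := ltnP n (k - i).
  by rewrite (qbin_small n (k - i)) // !(mulr0,mul0r,add0r).
rewrite mulrDr mulrDl; congr (_ + _).
have e : (m + n - k + (k - i) * (m - i) = n - (k - i) + (k - i).+1 * (m - i))%N.
  by rewrite mulSn; lia.
rewrite mulrCA -exprD e exprD; ring.
Qed.

Lemma qbin_vandermonde_dual m n k :
  qbin (m + n) k =
  \sum_(i < k.+1) qbin m i * qbin n (k - i) * 'X^(i * (n - (k - i))).
Proof.
rewrite addnC qbin_vandermonde (reindex_inj rev_ord_inj) /=.
apply: eq_bigr => i _; have le_ik : (i <= k)%N by rewrite -ltnS.
by rewrite subSS subKn // [qbin n _ * _]mulrC.
Qed.

(** Both sides are the q-multinomial coefficient with parts [i], [u], [t], [j]; only the grouping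
    differs. *)
Lemma qbin_tetranomial i u t j :
  qbin (i + u + (t + j)) (i + u) * (qbin (i + u) i * qbin (t + j) t) =
  qbin (i + u + (t + j)) i * (qbin (u + t + j) (u + t) * qbin (u + t) t).
Proof.
have nz : qpoch i * qpoch u * (qpoch t * qpoch j) != 0.
  by rewrite !mulf_neq0 ?qpoch_neq0.
apply: (mulIf nz).
transitivity (qpoch (i + u + (t + j))).
  by rewrite -(qbin_qpoch (i + u)) -(qbin_qpoch i) -(qbin_qpoch t); ring.
have e : (i + u + (t + j) = i + (u + t + j))%N by lia.
rewrite e -(qbin_qpoch i) -(qbin_qpoch (u + t)) (addnC u) -(qbin_qpoch t).
ring.
Qed.

(** * Central q-binomials and their two quadratic transformations *)

Definition cbin (L : nat) (x : int) : {poly int} := qbinom (L%:Z + L%:Z) (L%:Z - x).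

Lemma cbinE L x :
  cbin L x = if (`|x| <= L)%N then qbin (L + L) `|L%:Z - x|%N else 0.
Proof.
rewrite /cbin /qbinom.
have -> : (0 <= L%:Z - x) && (0 <= L%:Z + L%:Z - (L%:Z - x)) = (`|x| <= L)%N by lia.
case: ifP => // le_xL; rewrite gaussian_polyE; congr qbin; lia.
Qed.

Lemma cbinN L x : cbin L (- x) = cbin L x.
Proof.
rewrite !cbinE abszN; case: ifP => // le_xL.
have e : (L + L = `|(L%:Z - - x)%R| + `|(L%:Z - x)%R|)%N by lia.
by rewrite e qbin_sym.
Qed.

Lemma cbin_nat L (r : nat) : (r <= L)%N -> cbin L r = qbin (L + L) (L - r).
Proof. by move=> le_rL; rewrite cbinE absz_nat le_rL; congr qbin; lia. Qed.

Lemma cbin_small L (x : int) : (L < `|x|)%N -> cbin L x = 0.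
Proof. by rewrite cbinE ltnNge => /negbTE ->. Qed.

Lemma cbin_square L r : (r.*2 <= L)%N ->
  cbin L r.*2 =
  \sum_(b < (L - r.*2).+1) qbin L (b + r.*2) * qbin L b * 'X^(b * (b + r.*2)).
Proof.
move=> le_rL; rewrite cbin_nat // qbin_vandermonde (reindex_inj rev_ord_inj) /=.
apply: eq_bigr => -[b /=]; rewrite ltnS => le_b _.
rewrite subSS subKn //.
have e : (L = (b + r.*2) + (L - r.*2 - b))%N by lia.
have -> : qbin L (L - r.*2 - b) = qbin L (b + r.*2).
  by have := qbin_sym (b + r.*2) (L - r.*2 - b); rewrite -e.
by congr (_ * 'X^(_ * _)); lia.
Qed.

Lemma sum_triangle (V : nmodType) n (F : nat -> nat -> V) :
  \sum_(b < n.+1) \sum_(i < b.+1) F i (b - i)%N =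
  \sum_(i < n.+1) \sum_(t < (n - i).+1) F i t.
Proof.
elim: n => [|n IHn]; first by rewrite !big_ord1.
rewrite big_ord_recr IHn [in RHS]big_ord_recr /= [X in _ + X]big_ord_recr /=.
rewrite addrA subnn big_ord1; congr (_ + _).
rewrite -big_split /=; apply: eq_bigr => i _.
by rewrite subSn ?leq_ord // [in RHS]big_ord_recr.
Qed.

Lemma sum_ord_widen (V : nmodType) m n (F : nat -> V) :
    (m <= n)%N -> (forall i, (m <= i < n)%N -> F i = 0) ->
  \sum_(i < m) F i = \sum_(i < n) F i.
Proof.
move=> le_mn F0; rewrite (big_ord_widen n F) // big_mkcond /=.
apply: eq_bigr => i _; case: ltnP => // le_mi.
by rewrite F0 // le_mi ltn_ord.
Qed.

Lemma sum_ord_drop (V : nmodType) r n (F : nat -> V) :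
    (r <= n)%N -> (forall i, (i < r)%N -> F i = 0) ->
  \sum_(i < n) F i = \sum_(i < n - r) F (r + i)%N.
Proof.
move=> /subnKC; move: (n - r)%N => m <- F0.
by rewrite big_split_ord /= big1 ?add0r // => i _; rewrite F0.
Qed.

(** The kernel [A] is the case [e L k i] = (i+k)^2 + k^2, the kernel [C] the case k^2 + iL. *)
Definition doubling_kernel (e : nat -> nat -> nat -> nat) L k : {poly int} :=
  \sum_(i < L.+1) 'X^(e L k i) * qbin L i * qbin (L - i) k.*2.

(* Both quadratic transformations come from expanding [2L, L-2r] by the two
   forms of q-Vandermonde; [v] is the exponent of the form used second. *)
Lemma cbin_doubling (v : nat -> nat -> nat -> nat -> nat)
    (e : nat -> nat -> nat -> nat) (c : nat) :
    (forall m n k, qbin (m + n) k =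
       \sum_(i < k.+1) qbin m i * qbin n (k - i) * 'X^(v m n k i)) ->
    (forall r i t j, let L := (i + (r.*2 + t) + (t + j))%N in
       (c * r ^ 2 + (i + t) * (i + t + r.*2)
         + v (i + (r.*2 + t)) (t + j) (i + t) i = e L (r + t) i)%N) ->
  forall L (x : int),
  'X^(c * `|x| ^ 2) * cbin L (2 * x) =
  \sum_(k < L.+1) doubling_kernel e L k * cbin k x.
Proof.
move=> vandermonde eE L.
suff nat_case (r : nat) : 'X^(c * r ^ 2) * cbin L r.*2 =
    \sum_(k < L.+1) doubling_kernel e L k * cbin k r.
  move=> x; case: (intP x) => [|n|n].
  - exact: (nat_case 0%N).
  - by rewrite absz_nat -nat_case; congr (_ * cbin _ _); lia.
  rewrite abszN absz_nat mulrN cbinN; under eq_bigr do rewrite cbinN.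
  by rewrite -nat_case; congr (_ * cbin _ _); lia.
have [lt_Lr|le_rL] := ltnP L r.*2.
  rewrite cbin_small ?absz_nat // mulr0 big1 // => k _.
  have [lt_kr|le_rk] := ltnP k r; first by rewrite cbin_small ?mulr0 ?absz_nat.
  rewrite /doubling_kernel big1 ?mul0r // => i _.
  rewrite (qbin_small (L - i)) ?mulr0 //.
  by rewrite (leq_ltn_trans (leq_subr _ _)) // (leq_trans lt_Lr) ?leq_double.
(* [F i t] is the general term after both expansions and the regrouping by [qbin_tetranomial]; here
   k = r + t, and the last factor is [cbin k r]. *)
pose F i t := 'X^(e L (r + t)%N i) * qbin L i * qbin (L - i) (r + t).*2
                * qbin (r + t).*2 t.
have F0 i t : (L - r.*2 < i + t)%N -> F i t = 0.
  move=> lt_it; have [lt_Li|le_iL] := ltnP L i.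
    by rewrite /F (qbin_small L) // !(mulr0, mul0r).
  by rewrite /F (qbin_small (L - i)) ?mulr0 ?mul0r //; lia.
transitivity (\sum_(b < (L - r.*2).+1) \sum_(i < b.+1) F i (b - i)%N).
  rewrite cbin_square // big_distrr; apply: eq_bigr => -[b /= lt_b] _.
  (* Second use of q-Vandermonde, on [qbin L b]: its row is split at [b + r.*2], the lower index of
     the other factor, so that [qbin_tetranomial] applies. *)
  have Lb : (L = (b + r.*2) + (L - (b + r.*2)))%N by lia.
  rewrite {2}Lb vandermonde -mulrA mulrCA big_distrl /= big_distrr big_distrr.
  apply: eq_bigr => -[i /= lt_ib] _.
  have [lt_Lb|le_bL] := ltnP (L - (b + r.*2)) (b - i).
    rewrite /F (qbin_small (L - (b + _))) // (qbin_small (L - i)); last by lia.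
    by rewrite !(mul0r, mulr0).
  have [t bE] : exists t, b = (i + t)%N by exists (b - i)%N; lia.
  have [j LE] : exists j, L = (i + (r.*2 + t) + (t + j))%N.
    by exists (L - (i + (r.*2 + t) + t))%N; lia.
  have E1 : (L - (b + r.*2) = t + j)%N by lia.
  have E2 : (b + r.*2 = i + (r.*2 + t))%N by lia.
  have E3 : (b - i = t)%N by lia.
  have E4 : (L - i = r.*2 + t + t + j)%N by lia.
  have E5 : ((r + t).*2 = r.*2 + t + t)%N by lia.
  rewrite /F E1 E3 E4 E5 LE -eE E2 bE -!mulrA -qbin_tetranomial !exprD -!(addnA i).
  by rewrite [(t + r.*2)%N]addnC; ring.
rewrite sum_triangle.
(* As [F] vanishes outside the triangle, the inner sums extend to a rectangle and the summations can
   be exchanged. *)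
under eq_bigr => i _.
  rewrite (@sum_ord_widen _ _ (L.+1 - r)%N (F i)); [|lia|]; last first.
    by move=> t lt_t; apply: F0; lia.
  over.
rewrite exchange_big /=.
rewrite (@sum_ord_drop _ r _ (fun k => doubling_kernel e L k * cbin k r));
  [|lia|]; last first.
  by move=> k lt_kr; rewrite cbin_small ?absz_nat ?mulr0.
apply: eq_bigr => t _.
rewrite (@sum_ord_widen _ _ L.+1 (F^~ t)); [|lia|]; last first.
  by move=> i lt_i; apply: F0; lia.
rewrite cbin_nat ?leq_addr // big_distrl; apply: eq_bigr => i _.
by rewrite /F addnn addKn.
Qed.

Lemma cbin_doubling_two L (x : int) :
  'X^(2 * `|x| ^ 2) * cbin L (2 * x) =
  \sum_(k < L.+1)
    doubling_kernel (fun _ k i => (i + k) ^ 2 + k ^ 2)%N L k * cbin k x.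
Proof.
apply: (@cbin_doubling (fun m _ k i => (k - i) * (m - i))%N _ 2
  qbin_vandermonde) => r i t j /=.
have -> : (i + t - i = t)%N by lia.
have -> : (i + (r.*2 + t) - i = r.*2 + t)%N by lia.
by rewrite -!mul2n -!mulnn; ring.
Qed.

Lemma cbin_doubling_one L (x : int) :
  'X^(1 * `|x| ^ 2) * cbin L (2 * x) =
  \sum_(k < L.+1) doubling_kernel (fun L k i => k ^ 2 + i * L)%N L k * cbin k x.
Proof.
apply: (@cbin_doubling (fun _ n k i => i * (n - (k - i)))%N _ 1
  qbin_vandermonde_dual) => r i t j /=.
have -> : (t + j - (i + t - i) = j)%N by lia.
by rewrite -!mul2n -!mulnn; ring.
Qed.

(** * Nonnegative coefficients and their transfer along a doubling step *)

Definition nonneg_poly (p : {poly int}) : Prop := forall i, 0 <= p`_i.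

Lemma nonneg_poly0 : nonneg_poly 0.
Proof. by move=> i; rewrite coef0. Qed.

Lemma nonneg_polyXn n : nonneg_poly 'X^n.
Proof. by move=> i; rewrite coefXn ler0n. Qed.

Lemma nonneg_polyD p q : nonneg_poly p -> nonneg_poly q -> nonneg_poly (p + q).
Proof. by move=> p_ge0 q_ge0 i; rewrite coefD addr_ge0. Qed.

Lemma nonneg_polyM p q : nonneg_poly p -> nonneg_poly q -> nonneg_poly (p * q).
Proof. by move=> p_ge0 q_ge0 i; rewrite coefM sumr_ge0 // => j _; apply: mulr_ge0. Qed.

Lemma nonneg_poly_sum I (r : seq I) (F : I -> {poly int}) :
  (forall i, nonneg_poly (F i)) -> nonneg_poly (\sum_(i <- r) F i).
Proof.
move=> F_ge0; apply: big_ind => // [|p q]; first exact: nonneg_poly0.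
exact: nonneg_polyD.
Qed.

Lemma nonneg_poly1Xn n : nonneg_poly (1 + 'X^n).
Proof. by apply: nonneg_polyD (nonneg_polyXn 0) (nonneg_polyXn n). Qed.

Lemma qbin_nonneg n k : nonneg_poly (qbin n k).
Proof.
elim: n k => [|n IHn] [|k].
- by rewrite qbin0; apply: nonneg_polyXn 0.
- by rewrite qbin_small //; apply: nonneg_poly0.
- by rewrite qbin0; apply: nonneg_polyXn 0.
rewrite qbinS; apply: nonneg_polyD => //; apply: nonneg_polyM => //.
exact: nonneg_polyXn.
Qed.

Lemma doubling_kernel_nonneg e L k : nonneg_poly (doubling_kernel e L k).
Proof.
apply: nonneg_poly_sum => i; apply: nonneg_polyM (qbin_nonneg _ _).
exact: nonneg_polyM (nonneg_polyXn _) (qbin_nonneg _ _).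
Qed.

Definition int_range (B : nat) : seq int := [seq i%:Z - B%:Z | i <- iota 0 B.*2.+1].

Lemma mem_int_range B x : (x \in int_range B) = (`|x| <= B)%N.
Proof.
apply/mapP/idP => [[i]|le_xB]; first by rewrite mem_iota => ? ->; lia.
by exists `|(x + B%:Z)%R|%N; rewrite ?mem_iota; lia.
Qed.

Lemma int_range_uniq B : uniq (int_range B).
Proof. by rewrite map_inj_uniq ?iota_uniq // => i j /addIr[]. Qed.

Definition alt_sum (E : int -> nat) (w B L : nat) : {poly int} :=
  \sum_(j <- int_range B) (-1) ^+ `|j| * ('X^(E j) * cbin L (w%:Z * j)).

(** For [w > 0] a window [B >= L] contains all nonzero terms. Admitting every such [B] lets one
    window serve all levels [k <= L] of a doubling step. *)
Definition alt_positive (E : int -> nat) (w : nat) : Prop :=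
  forall L B, (L <= B)%N -> nonneg_poly (alt_sum E w B L).

(** The kernel does not depend on [j], so it factors out: the sum at level [L] and width [2w] is a
    nonnegative combination of the sums at levels [k <= L] and width [w]. *)
Lemma alt_positive_doubling e c E w :
    (forall L (x : int), 'X^(c * `|x| ^ 2) * cbin L (2 * x) =
       \sum_(k < L.+1) doubling_kernel e L k * cbin k x) ->
    alt_positive E w ->
  alt_positive (fun j => (E j + c * `|(w%:Z * j)%R| ^ 2)%N) w.*2.
Proof.
move=> doubling posE L B le_LB.
have -> : alt_sum (fun j => (E j + c * `|(w%:Z * j)%R| ^ 2)%N) w.*2 B L =
    \sum_(k < L.+1) doubling_kernel e L k * alt_sum E w B k.
  under [RHS]eq_bigr do rewrite big_distrr.
  rewrite exchange_big /=; apply: eq_bigr => j _.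
  have -> : w.*2%:Z * j = 2 * (w%:Z * j) by lia.
  rewrite exprD -mulrA doubling !big_distrr; apply: eq_bigr => k _ /=; ring.
apply: nonneg_poly_sum => k; apply: nonneg_polyM; first exact: doubling_kernel_nonneg.
apply: posE.
by rewrite (leq_trans _ le_LB) // leq_ord.
Qed.

(** * Finite Jacobi triple product, summed along multiples of K *)

Definition tri (x : int) : nat :=
  match x with Posz n => 'C(n, 2) | Negz n => 'C(n.+2, 2) end.

Lemma triE x : (tri x)%:Z * 2 = x * (x - 1).
Proof.
have bin2E n : ('C(n.+1, 2) * 2 = n.+1 * n)%N.
  by elim: n => // n IHn; rewrite binS bin1 mulnDl IHn; ring.
case: x => [[|n]|n] //=; first by rewrite -PoszM bin2E; lia.
by rewrite -PoszM bin2E NegzE; lia.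
Qed.

Lemma qbinSS n k :
  qbin n.+2 k.+2 =
  (1 + 'X^(n.+1)) * qbin n k.+1 + 'X^(k.+2) * qbin n k.+2 + 'X^(n - k) * qbin n k.
Proof.
rewrite qbinS (qbinS_dual n k) (qbinS_dual n k.+1).
have [lt_kn|le_nk] := ltnP k n; last first.
  by rewrite (qbin_small n k.+1) //; ring.
have e : (n.+1 = k.+2 + (n - k.+1))%N by lia.
by rewrite [in 'X^(n.+1)]e exprD; ring.
Qed.

Lemma qbinSS1 n : qbin n.+2 1 = 1 + 'X^(n.+1) + 'X * qbin n 1.
Proof. by rewrite qbinS (qbinS_dual n 0) !qbin0 subn0 (exprS _ n) !expr1; ring. Qed.

(** Two Pascal steps lead from row 2M to row 2M+2; evenness in [x] reduces to [x >= 0]. *)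
Lemma cbinS M (x : int) :
  cbin M.+1 x = (1 + 'X^(M.*2.+1)) * cbin M x
    + 'X^(`|M.+1%:Z - x|) * cbin M (x - 1) + 'X^(`|M.+1%:Z + x|) * cbin M (x + 1).
Proof.
wlog : x / 0 <= x => [nat_case|].
  have [/nat_case //|lt_x0] := leP 0 x.
  have := nat_case (- x); rewrite cbinN => ->; last by lia.
  rewrite cbinN opprK -(cbinN _ (x - 1)) -(cbinN _ (x + 1)) opprB opprD.
  by rewrite [1 - x]addrC addrAC.
case: x => // r _.
have ME : (M.+1 + M.+1 = (M + M).+2)%N by lia.
have [lt_Mr|le_rM] := ltnP M r.
  rewrite !(cbin_small M r) ?(cbin_small M (r + 1)); [|lia|lia].
  rewrite !mulr0 addr0 add0r.
  have [lt_M1r|le_rM1] := ltnP M.+1 r.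
    by rewrite !cbin_small ?mulr0 //; lia.
  have -> : r = M.+1 by lia.
  have -> : M.+1%:Z - 1 = M by lia.
  by rewrite !cbin_nat // !subnn !qbin0 subrr mulr1.
have prevE : cbin M (r%:Z - 1) = qbin (M + M) (M - r).+1.
  case: r le_rM => [|r] le_rM.
    rewrite subn0 sub0r cbinN; case: (M) => [|N].
      by rewrite cbin_small ?qbin_small.
    have e : (N.+1 + N.+1 = N + N.+2)%N by lia.
    by rewrite cbin_nat // subn1 e qbin_sym.
  have -> : r.+1%:Z - 1 = r by lia.
  by rewrite cbin_nat; [congr qbin|]; lia.
rewrite (cbin_nat M.+1) ?(leqW le_rM) // (cbin_nat M r) // prevE ME subSn //.
have -> : (`|M.+1%:Z - r%:Z| = (M - r).+1)%N by lia.
have -> : (M.*2.+1 = (M + M).+1)%N by rewrite addnn.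
have [lt_rM|le_Mr] := ltnP r M; last first.
  have -> : (M - r = 0)%N by lia.
  by rewrite qbinSS1 (cbin_small M (r%:Z + 1)) ?qbin0 ?expr1; [ring|lia].
have -> : r%:Z + 1 = r.+1 by lia.
have -> : (M - r = (M - r.+1).+1)%N by lia.
rewrite cbin_nat // qbinSS; congr (_ + 'X^_ * _); lia.
Qed.

(** The coefficient of z^x in prod_(i<M) (1 + z q^i)(1 + q^(i+1)/z). *)
Definition qterm M (x : int) : {poly int} := 'X^(tri x) * cbin M x.

(** Multiplication by the new factor (1 + z q^M)(1 + q^(M+1)/z). *)
Lemma qtermS M x :
  qterm M.+1 x = (1 + 'X^(M.*2.+1)) * qterm M x
    + 'X^M * qterm M (x - 1) + 'X^(M.+1) * qterm M (x + 1).
Proof.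
rewrite /qterm cbinS !mulrDr !mulrA.
(* The exponents contain absolute values and agree only for [|z| <= M]; beyond that [cbin M z] is
   0. *)
have shift (a b c d : nat) (z : int) : ((`|z| <= M)%N -> a + b = c + d)%N ->
    'X^a * 'X^b * cbin M z = 'X^c * 'X^d * cbin M z.
  move=> e; case: (leqP `|z| M) => [/e e'|lt_Mz]; first by rewrite -!exprD e'.
  by rewrite (cbin_small _ _ lt_Mz) !mulr0.
have t0 := triE x; have t1 := triE (x - 1); have t2 := triE (x + 1).
congr (_ + _ + _); first by rewrite [_ * 'X^(tri x)]mulrC.
  by apply: shift => le_z; nia.
by apply: shift => le_z; nia.
Qed.

Definition alt_qterm (B K M : nat) (x : int) : {poly int} :=
  \sum_(j <- int_range B) (-1) ^+ `|j| * qterm M (x + K%:Z * j).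

Lemma alt_qtermS B K M x :
  alt_qterm B K M.+1 x = (1 + 'X^(M.*2.+1)) * alt_qterm B K M x
    + 'X^M * alt_qterm B K M (x - 1) + 'X^(M.+1) * alt_qterm B K M (x + 1).
Proof.
rewrite /alt_qterm !big_distrr -!big_split /=; apply: eq_bigr => j _.
rewrite qtermS (addrAC x (-1)) (addrAC x 1); ring.
Qed.

(** The values of [alt_qterm] for the empty product M = 0. *)
Definition comb (K : nat) (x : int) : {poly int} :=
  if (K%:Z %| x)%Z then (-1) ^+ `|(x %/ K%:Z)%Z| else 0.

Lemma alt_qterm0 B K x : (0 < K)%N -> (`|x| <= B)%N ->
  alt_qterm B K 0 x = comb K x.
Proof.
move=> K_gt0 le_xB; rewrite /alt_qterm /comb /qterm.
have small (j : int) : x + K%:Z * j != 0 -> cbin 0 (x + K%:Z * j) = 0.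
  by move=> nz; rewrite cbin_small // absz_gt0.
case: ifP => [/dvdzP[y xE]|ndvd]; last first.
  rewrite big1_seq // => j _; rewrite small ?mulr0 //.
  apply: contraFN ndvd => /eqP e; apply/dvdzP; exists (- j).
  by move: e; rewrite mulrC; lia.
rewrite xE mulzK; last by lia.
rewrite (bigD1_seq (- y)) ?int_range_uniq //=; last first.
  rewrite mem_int_range; nia.
rewrite big1 ?addr0 => [|j nj]; last first.
  rewrite -xE small ?mulr0 // xE mulrC -mulrDr mulf_neq0 //; lia.
have -> : y * K%:Z + K%:Z * - y = 0 by ring.
by rewrite cbin_nat //= subnn qbin0 !mulr1 abszN.
Qed.

Lemma comb_mul K y : (0 < K)%N -> comb K (y * K%:Z) = (-1) ^+ `|y|.
Proof. by move=> K_gt0; rewrite /comb dvdz_mull // mulzK //; lia. Qed.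

Lemma comb_shift K x : (0 < K)%N -> comb K (x + K%:Z) = - comb K x.
Proof.
move=> K_gt0; have [/dvdzP[y ->]|ndvd] := boolP (K%:Z %| x)%Z; last first.
  by rewrite /comb rpredDr // (negbTE ndvd) oppr0.
have -> : y * K%:Z + K%:Z = (y + 1) * K%:Z by ring.
rewrite !comb_mul //; have [y_ge0|y_lt0] := leP 0 y.
  have -> : (`|(y + 1)%R| = `|y|.+1)%N by lia.
  by rewrite exprS mulN1r.
have -> : (`|y| = `|(y + 1)%R|.+1)%N by lia.
by rewrite exprS mulN1r opprK.
Qed.

Lemma combN K x : (0 < K)%N -> comb K (- x) = comb K x.
Proof.
move=> K_gt0; have [/dvdzP[y ->]|ndvd] := boolP (K%:Z %| x)%Z.
  by rewrite -mulNr !comb_mul // abszN.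
by rewrite /comb rpredN (negbTE ndvd).
Qed.

Lemma comb_small K x : (`|x| < K)%N -> x != 0 -> comb K x = 0.
Proof.
rewrite /comb => lt_xK nz; case: ifP => // /dvdzP[y xE].
move: lt_xK nz; rewrite xE abszM absz_nat mulf_eq0 negb_or => lt_yK /andP[ynz _].
by move: lt_yK; rewrite ltnNge leq_pmull // absz_gt0.
Qed.

Lemma comb0 K : comb K 0 = 1.
Proof. by rewrite /comb dvdz0 div0z. Qed.

(** * The wave recursion and the initial case d = m = 1 *)

(** Acts on coefficient sequences as multiplication by prod_(0<i<=M) (1 + z q^i)(1 + q^i/z). *)
Fixpoint wave (g : int -> {poly int}) (M : nat) (x : int) : {poly int} :=
  match M with
  | 0%N => g x
  | N.+1 => (1 + 'X^(N.+1 * 2)) * wave g N x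
              + 'X^(N.+1) * (wave g N (x - 1) + wave g N (x + 1))
  end.

(** The factors are invariant under z -> 1/z, so the recursion commutes with reflections. *)
Lemma wave_reflect g (s : {poly int}) c :
  (forall x, g (c - x) = s * g x) -> forall M x, wave g M (c - x) = s * wave g M x.
Proof.
move=> gE; elim=> //= M IHM x.
have -> : c - x - 1 = c - (x + 1) by ring.
have -> : c - x + 1 = c - (x - 1) by ring.
by rewrite !IHM; ring.
Qed.

Lemma wave_shiftD g M x :
  wave (fun y => g y + g (y + 1)) M x = wave g M x + wave g M (x + 1).
Proof.
by elim: M x => //= M IHM x; rewrite !IHM (addrAC x (-1)); ring.
Qed.

(** Antisymmetry about the walls persists, so at a wall the two neighbours cancel; strictly between
    the walls both neighbours still lie in the interval. *)
Lemma wave_nonneg g a b :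
    (forall x, g (2 * a - x) = -1 * g x) -> (forall x, g (2 * b - x) = -1 * g x) ->
    (forall x, a <= x <= b -> nonneg_poly (g x)) ->
  forall M x, a <= x <= b -> nonneg_poly (wave g M x).
Proof.
move=> ga gb g_ge0; elim=> [|M IHM] x /=; first exact: g_ge0.
move=> x_ab; apply: nonneg_polyD.
  by apply: nonneg_polyM; [apply: nonneg_poly1Xn | apply: IHM].
apply: nonneg_polyM; first exact: nonneg_polyXn.
have wall c : (forall x, g (2 * c - x) = -1 * g x) ->
    wave g M (c - 1) + wave g M (c + 1) = 0.
  move=> gc; have -> : c - 1 = 2 * c - (c + 1) by ring.
  by rewrite (wave_reflect _ _ _ gc) mulN1r addNr.
have [->|ne_xa] := eqVneq x a; first by rewrite wall //; apply: nonneg_poly0.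
have [->|ne_xb] := eqVneq x b; first by rewrite wall //; apply: nonneg_poly0.
by apply: nonneg_polyD; apply: IHM; lia.
Qed.

(* The truncation of the sum to [-B, B] breaks its antiperiodicity in [x] only
   away from the origin; hence the bound on [x]. *)
Lemma alt_qterm_wave B K M x : (0 < K)%N -> (`|x| + M.+1 <= B)%N ->
  let u := wave (comb K) M in
  alt_qterm B K M.+1 x = u x + u (x - 1) + 'X^(M.+1) * (u (x + 1) + u x).
Proof.
move=> K_gt0; elim: M x => [|M IHM] x le_B u.
  rewrite alt_qtermS !alt_qterm0 //= ?expr0 ?expr1; [|lia..].
  by rewrite /u /=; ring.
rewrite alt_qtermS !IHM; [|lia..].
rewrite {}/u /= ?addrK ?subrK.
have -> : (M.+1.*2.+1 = M.+1 + M.+2)%N by lia.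
have -> : (M.+1 * 2 = M.+1 + M.+1)%N by lia.
rewrite !exprD !(exprS _ M.+1).
move: ('X^(M.+1)) (wave _ _) => p u; ring.
Qed.

Lemma alt_positive_base K : (0 < K)%N -> alt_positive (fun j => tri (K%:Z * j)) K.
Proof.
move=> K_gt0 L B le_LB.
have -> : alt_sum (fun j => tri (K%:Z * j)) K B L = alt_qterm B K L 0.
  by apply: eq_bigr => j _; rewrite add0r.
case: L le_LB => [|M] le_LB.
  by rewrite alt_qterm0 // comb0; apply: nonneg_polyXn 0.
rewrite alt_qterm_wave //; set u := wave _ _.
(* Evenness identifies [u (-1)] with [u 1], so the asymmetric factors collapse to a multiple of
   [u 0 + u 1]. *)
have uN x : u (- x) = u x.
  rewrite /u -sub0r (wave_reflect _ 1 0) ?mul1r // => y.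
  by rewrite sub0r combN ?mul1r.
have -> : u 0 + u (0 - 1) + 'X^(M.+1) * (u (0 + 1) + u 0) =
    (1 + 'X^(M.+1)) * (u 0 + u 1).
  by rewrite sub0r uN add0r; ring.
apply: nonneg_polyM; first exact: nonneg_poly1Xn.
have comb_ge0 x : (`|x| < K)%N -> nonneg_poly (comb K x).
  have [->|nz] := eqVneq x 0; first by rewrite comb0; move=> _; apply: nonneg_polyXn 0.
  by move=> lt_xK; rewrite comb_small //; apply: nonneg_poly0.
have combK x : comb K (K%:Z - x) = - comb K x.
  by rewrite addrC comb_shift // combN.
have combNK x : comb K (- K%:Z - x) = - comb K x.
  by rewrite -opprD combN // addrC comb_shift.
(* The walls of [u] are at +-K/2. For odd [K] these are not integers, but the
   walls of [u x + u (x + 1)] are, being shifted by 1/2. *)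
have [oddK|evenK] := boolP (odd K); last first.
  have u_ge0 : forall x, - (K./2)%:Z <= x <= K./2%:Z -> nonneg_poly (u x).
    apply: wave_nonneg => x.
    - by rewrite mulN1r -combNK; congr (comb _ (_ - _)); lia.
    - by rewrite mulN1r -combK; congr (comb _ (_ - _)); lia.
    by move=> x_K; apply: comb_ge0; lia.
  by apply: nonneg_polyD; apply: u_ge0; lia.
rewrite -[1]add0r -wave_shiftD.
apply: (@wave_nonneg _ (- (K./2)%:Z - 1) (K./2%:Z)); last by lia.
- by move=> x; rewrite mulN1r opprD -!combNK addrC; congr (comb _ _ + comb _ _); lia.
- by move=> x; rewrite mulN1r opprD -!combK addrC; congr (comb _ _ + comb _ _); lia.
(* For K = 1 the interval contains -1, where [|x| < K] fails; there the two teeth cancel instead. *)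
move=> x x_K; have [K1|K_gt1] := eqVneq K 1%N.
  by rewrite K1 comb_shift // subrr; apply: nonneg_poly0.
by apply: nonneg_polyD; apply: comb_ge0; lia.
Qed.

(** * Induction along the sequence [a] *)

(** For m = 2 mu + 1 the powers of 2 in alpha, beta and 2^(d-1) K cancel, and the exponent in the
    j-th term of [G] is Kj(mKj - 1)/2. The witness [E] shows that it is a natural number. *)
Definition bressoud_positive (R : realType) (K d : nat) (m : R) : Prop :=
  exists2 E : int -> nat,
    forall j : int, (E j)%:R * 2 = K%:R * j%:~R * (m * (K%:R * j%:~R) - 1) :> R &
    alt_positive E (2 ^ d.-1 * K).

Lemma bressoud_positive_base (R : realType) K :
  (0 < K)%N -> bressoud_positive R K 1 1.
Proof.
move=> K_gt0; exists (fun j => tri (K%:Z * j)); last first.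
  by rewrite mul1n; apply: alt_positive_base.
move=> j; have /(congr1 (fun x : int => x%:~R : R)) := triE (K%:Z * j).
by rewrite !(intrM, intrB) => ->; rewrite mul1r.
Qed.

(** The added exponent c (2^(d-1) K j)^2 amounts to raising m by c 4^d/2. *)
Lemma bressoud_positive_doubling (R : realType) K d m e c :
    (forall L (x : int), 'X^(c * `|x| ^ 2) * cbin L (2 * x) =
       \sum_(k < L.+1) doubling_kernel e L k * cbin k x) ->
    (0 < d)%N -> bressoud_positive R K d m ->
  bressoud_positive R K d.+1 (m + c%:R * (4 ^+ d / 2)).
Proof.
move=> doubling; case: d => // d _ [E EE posE] /=.
exists (fun j => (E j + c * `|((2 ^ d * K)%N%:Z * j)%R| ^ 2)%N); last first.
  rewrite expnS -mulnA mul2n; exact: alt_positive_doubling doubling posE.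
move=> j; rewrite natrD mulrDl EE natrM natrX.
have -> : `|((2 ^ d * K)%N%:Z * j)%R|%:R ^+ 2 = (2 ^+ d * K%:R * j%:~R) ^+ 2 :> R.
  rewrite natr_absz intr_norm real_normK ?num_real // intrM PoszM intrM.
  by rewrite -!pmulrn natrX.
have -> : 4 = 2 ^+ 2 :> R by rewrite -natrX.
by rewrite -exprM mulnC exprM (exprS _ d); field.
Qed.

(** The increments 4^d, ..., 4^(k+d-1) of [k] steps [A] form a geometric sum. *)
Lemma bressoud_positive_iter (R : realType) K d m k :
    (0 < d)%N -> bressoud_positive R K d m ->
  bressoud_positive R K (k + d) (m + (4 ^+ (k + d) - 4 ^+ d) / 3).
Proof.
move=> d_gt0 posm; elim: k => [|k IHk]; first by rewrite subrr mul0r addr0.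
have := bressoud_positive_doubling _ _ _ _ _ _ cbin_doubling_two _ IHk.
rewrite addSn => /(_ (ltn_addl _ d_gt0)); congr (bressoud_positive _ _ _ _).
by rewrite exprS; field.
Qed.

Lemma tail_sum_lift n (a : 'I_n.+2 -> nat) i :
  tail_sum a (lift ord0 i) = tail_sum (fun j => a (lift ord0 j)) i.
Proof.
rewrite /tail_sum big_mkcond big_ord_recl /= add0n [RHS]big_mkcond.
by apply: eq_bigr => j _.
Qed.

Lemma tail_sum0 n (a : 'I_n.+1 -> nat) : tail_sum a ord0 = total_sum a.
Proof. by apply: eq_bigl. Qed.

Lemma muE (R : realType) n (a : 'I_n.+1 -> nat) :
  2 * mu R a + 1 = (4 ^+ total_sum a - 1) / 3
     - \sum_(i < n.+1 | (0 < i)%N) 4 ^+ tail_sum a i / 8.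
Proof.
have four (t k : nat) : 4 ^ (t%:Z - k%:Z) = 4 ^+ t / 4 ^+ k :> R.
  by rewrite expfzDr ?pnatr_eq0 // -exprnN.
rewrite /mu four mulrBr big_distrr /=.
under eq_bigr => i _ do rewrite four.
rewrite addrAC; congr (_ - _); first by field.
by apply: eq_bigr => i _; field.
Qed.

Lemma total_sum_recl n (a : 'I_n.+2 -> nat) :
  total_sum a = (a ord0 + total_sum (fun j => a (lift ord0 j)))%N.
Proof. exact: big_ord_recl. Qed.

Lemma sum_tail_recl (V : nmodType) n (a : 'I_n.+2 -> nat) (F : nat -> V) :
  \sum_(i < n.+2 | (0 < i)%N) F (tail_sum a i) =
  F (total_sum (fun j => a (lift ord0 j)))
    + \sum_(i < n.+1 | (0 < i)%N) F (tail_sum (fun j => a (lift ord0 j)) i).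
Proof.
rewrite big_mkcond big_ord_recl /= add0r -tail_sum0.
rewrite [X in _ + X]big_mkcond !big_ord_recl /= add0r tail_sum_lift.
by congr (_ + _); apply: eq_bigr => i _; rewrite tail_sum_lift.
Qed.

(** Induction on [n], removing a_0: the case of the shortened sequence is followed by one step [C]
    and a_0 steps [A]. *)
Lemma mu_bressoud_positive (R : realType) K n (a : 'I_n.+1 -> nat) :
    (0 < K)%N ->
    (forall i : 'I_n.+1, (0 < i < n)%N -> (1 <= a i)%N) ->
    (2 - (n == 0) <= a ord_max)%N ->
  (0 < total_sum a)%N /\ bressoud_positive R K (total_sum a) (2 * mu R a + 1).
Proof.
move=> K_gt0; elim: n a => [|n IHn] a ha han.
  have totalE : total_sum a = ((a ord_max).-1 + 1)%N.
    by rewrite /total_sum big_ord1 addn1 prednK //; congr (a _); apply: val_inj.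
  split; first by rewrite totalE addn1.
  have := bressoud_positive_iter R K 1 1 (a ord_max).-1 isT
            (bressoud_positive_base R K K_gt0).
  rewrite muE big1 => [|i]; last by rewrite ord1.
  by rewrite totalE; congr (bressoud_positive _ _ _ _); field.
pose b (j : 'I_n.+1) := a (lift ord0 j).
(* The step [C] itself raises d by 1, so the first entry is lowered by 1. It may become 0 if
   [n > 0]; if [n = 0] it stays at least 1, as the weaker bound there demands. *)
pose b' j := (b j - (j == ord0))%N.
have b_max : (2 <= b ord_max)%N.
  by rewrite /b (_ : lift _ _ = ord_max) //; apply: val_inj.
have b_gt0 : (0 < b ord0)%N.
  have [n0|n_gt0] := posnP n; last by apply: ha; rewrite lift0.
  by rewrite (_ : ord0 = ord_max) ?(ltnW b_max) //; apply: val_inj.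
have totalE : total_sum b = (total_sum b').+1.
  rewrite /total_sum (bigD1 ord0) //= [in RHS](bigD1 ord0) //=.
  rewrite /b' eqxx subn1 -addSn prednK //; congr (_ + _)%N.
  by apply: eq_bigr => i /negbTE ->; rewrite subn0.
have [||b'_gt0 posb'] := IHn b'.
- move=> i /andP[i_gt0 lt_in]; rewrite /b' (_ : i == ord0 = false) ?subn0.
    by apply: ha; rewrite lift0 ltnS.
  by apply/negbTE; rewrite -val_eqE /= -lt0n.
- by rewrite /b' -val_eqE /=; case: (n == 0%N); lia.
split; first by rewrite total_sum_recl -/b totalE addnS.
have := bressoud_positive_doubling _ _ _ _ _ _ cbin_doubling_one b'_gt0 posb'.
move=> /(bressoud_positive_iter _ _ _ _ (a ord0) (ltn0Sn _)).
rewrite -totalE -total_sum_recl; congr (bressoud_positive _ _ _ _).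
rewrite !muE (sum_tail_recl _ _ _ (fun t => 4 ^+ t / 8)) -/b.
(* Tail sums with i > 0 omit entry 0, the only one where [b'] differs from [b]. *)
have -> : \sum_(i < n.+1 | (0 < i)%N) 4 ^+ tail_sum b i / 8 =
    \sum_(i < n.+1 | (0 < i)%N) 4 ^+ tail_sum b' i / 8 :> R.
  apply: eq_bigr => i i_gt0; congr (4 ^+ _ / 8); apply: eq_bigr => j le_ij.
  rewrite /b' (_ : j == ord0 = false) ?subn0 //.
  by apply/negbTE; rewrite -val_eqE /= -lt0n (leq_trans i_gt0).
by rewrite totalE !exprS; field.
Qed.

(** * From integer polynomials back to sums with real exponents *)

Lemma mcoeff_qshift (R : realType) (n : nat) p (x : R) :
  (qshift (n%:R : R) p)@_x =
  if x \is a Num.nat then ('X^n * p)`_(Num.truncn x) else 0.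
Proof.
rewrite /qshift raddf_sum /=; under eq_bigr => i _ do rewrite mcoeffU -natrD.
case: ifPn => [/natrP[k ->]|x_nat]; last first.
  apply: big1 => i _; case: eqP => // e; case/negP: x_nat.
  by rewrite -e; apply/natrP; exists (n + i)%N.
rewrite natrK coefXnM; under eq_bigr => i _ do rewrite eqr_nat.
case: ltnP => [lt_kn|/subnKC {1}<-].
  by rewrite big1 // => i _; case: eqP => // e; lia.
under eq_bigr do rewrite eqn_add2l.
have [lt_kp|le_pk] := ltnP (k - n) (size p).
  rewrite (bigD1 (Ordinal lt_kp)) //= eqxx big1 ?addr0 // => i.
  by rewrite -val_eqE /= => /negbTE ->.
rewrite nth_default // big1 // => i _; case: eqP => // e.
by have := ltn_ord i; rewrite e ltnNge le_pk.
Qed.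

Lemma coef_signM n (p : {poly int}) i :
  ((-1) ^+ n * p)`_i = (-1) ^+ n * p`_i.
Proof.
by elim: n => [|n IHn]; rewrite ?expr0 ?mul1r // !exprS !mulN1r !mulNr coefN IHn.
Qed.

Lemma G_coef_nonneg (R : realType) (M w : nat) (alpha beta : R) (E : int -> nat) :
    (0 < w)%N ->
    (forall j : int, w%:R * j%:~R * ((alpha + beta) * j%:~R + alpha - beta) / 2
       = (E j)%:R) ->
    alt_positive E w -> coef_nonneg (G M%:Z M%:Z alpha beta w%:Z).
Proof.
move=> w_gt0 EE posE x.
have -> : G M%:Z M%:Z alpha beta w%:Z =
    \sum_(j <- int_range M)
      ((-1) ^ j : int) *: qshift ((E j)%:R : R) (cbin M (w%:Z * j)).
  rewrite fsbig_seq ?int_range_uniq // (fsbig_widen _ setT) //.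
    by apply: eq_fsbigr => j _; rewrite /cbin -EE.
  (* For [|j| > M] also [|w j| > M], as [w > 0], so the term is 0. *)
  move=> j [_ /negP]; rewrite /= mem_int_range -ltnNge => lt_Mj.
  rewrite -/(cbin M (w%:Z * j)) cbin_small; last by nia.
  by rewrite /qshift size_poly0 big_ord0 scaler0.
rewrite raddf_sum /=.
have -> : \sum_(j <- int_range M)
     (((-1) ^ j : int) *: qshift ((E j)%:R : R) (cbin M (w%:Z * j)))@_x =
   if x \is a Num.nat then (alt_sum E w M M)`_(Num.truncn x) else 0.
  under eq_bigr do rewrite mcoeffZ mcoeff_qshift.
  case: ifP => _; last by rewrite big1 // => j _; rewrite mulr0.
  rewrite /alt_sum coef_sum; apply: eq_bigr => j _.
  have sgnE : (-1) ^ j = (-1) ^+ `|j| :> int.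
    by case: (intP j) => // k; rewrite abszN -exprnN -exprVn invrN1.
  by rewrite sgnE coef_signM.
by case: ifP => // _; apply: posE.
Qed.

Theorem theorem1p5 (R : realType) (n : nat) (a : 'I_n.+1 -> nat)
    (ha : forall i : 'I_n.+1, (0 < i < n)%N -> (1 <= a i)%N)
    (han : (2 - (n == 0) <= a ord_max)%N)
    (K : nat) (hK : (0 < K)%N) (M : nat) :
  let d := total_sum a in
  coef_nonneg
    (G M%:Z M%:Z
       (((2 * mu R a + 1) * K%:R - 1) / 2 ^+ d)
       (((2 * mu R a + 1) * K%:R + 1) / 2 ^+ d)
       (2 ^ (d%:Z - 1) * K%:Z)).
Proof.
move=> d; have [] := mu_bressoud_positive R K n a hK ha han.
(* Positivity of [d] makes 2^(d-1) K a natural number. *)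
rewrite -/d; case: d => // d _ [E EE posE].
have -> : 2 ^ (d.+1%:Z - 1) * K%:Z = (2 ^ d * K)%N%:Z.
  have -> : d.+1%:Z - 1 = d by lia.
  by rewrite PoszM -exprnP -[(2 ^ d)%N%:Z]natz natrX.
apply: G_coef_nonneg posE => [|j]; first by rewrite muln_gt0 expn_gt0.
apply: (@mulIf _ 2); first by rewrite pnatr_eq0.
rewrite EE natrM natrX exprS; field.
by rewrite expf_neq0 ?pnatr_eq0.
Qed.
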